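(* Suppose that for any $\theta\in\mathbb{R}^m$ such that $\hat c_\theta(x)\neq 0$ almost surely, the problem $\min_{w\in W}\hat c_\theta(x)^\top w$ has a unique solution with probability $1$ when $(x,c)\sim P$. Let $\beta\in\mathbb{R}$ be such that $\beta^\star_{\mathcal H,P}\le \beta<\beta_{\max,P}$. Then for every $\theta\in\mathbb{R}^m$ with $\hat c_\theta(x)\neq 0$ almost surely, $\ell_P(\theta)\le\beta$ if and only if $\theta$ is a minimizer of $\ell_P^\beta$ over $\mathbb{R}^m$. In particular, when $\beta=\beta^\star_{\mathcal H,P}$, such a $\theta$ is a minimizer of $\ell_P^\beta$ if and only if it is a minimizer of $\ell_P$.
   Context: $P$ is a joint probability distribution of $(x,c)$ with $x\in\mathbb{R}^k$ (context) and $c\in\mathbb{R}^d$ (cost). $W\subset\mathbb{R}^d$ is a nonempty, convex, closed and bounded set of decisions. $\mathcal H=\{\hat c_\theta:\theta\in\mathbb{R}^m\}$ is a parametric family of measurable functions $\hat c_\theta:\mathbb{R}^k\to\mathbb{R}^d$; all expectations below are assumed finite. For $\tilde c\in\mathbb{R}^d$, $W^\star(\tilde c)=\arg\min_{w\in W}\tilde c^\top w$. The target loss is $\ell_P(\theta)=\mathbb{E}_{(x,c)\sim P}\big(\max_{w\in W^\star(\hat c_\theta(x))}c^\top w\big)$. Set $\beta^\star_{\mathcal H,P}=\min_{\theta\in\mathbb{R}^m}\ell_P(\theta)$ (assumed attained) and $\beta_{\max,P}=\mathbb{E}_{(x,c)\sim P}(\max_{w\in W}c^\top w)$. $W_P$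 is the set of measurable mappings $w_P$ from contexts $x$ to $W$, and $\overline W_P^\beta=\{\overline w_P\in W_P:\ \mathbb{E}_{(x,c)\sim P}(c^\top\overline w_P(x))\le\beta\}$. The CILO loss is $$\ell_P^\beta(\theta)=\min_{\overline w\in\overline W_P^\beta}\mathbb{E}_{(x,c)\sim P}\big(\hat c_\theta(x)^\top\overline w(x)\big)-\min_{w\in W_P}\mathbb{E}_{(x,c)\sim P}\big(\hat c_\theta(x)^\top w(x)\big).$$ *)

(* Defs.v *)
From HB Require Import structures.
From mathcomp Require Import all_boot all_order all_algebra.
From mathcomp Require Import all_classical all_reals all_analysis.

Set Implicit Arguments.
Unset Strict Implicit.
Unset Printing Implicit Defensive.

Import Order.TTheory GRing.Theory Num.Theory.
Import numFieldNormedType.Exports.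

Local Open Scope classical_set_scope.
Local Open Scope ring_scope.

(* Matrices, hence vectors of R^n, carry the Borel sigma-algebra. *)
HB.instance Definition _ (R : realType) (p q : nat) :=
  Measurable.copy 'M[R]_(p, q) (g_sigma_algebraType (@open 'M[R]_(p, q))).

Definition minimizer {T : Type} {R : realType} (f : T -> \bar R) (t : T) : Prop :=
  forall t', (f t <= f t')%E.

Definition dot {R : realType} {d : nat} (u v : 'rV[R]_d) : R :=
  \sum_(i < d) u ord0 i * v ord0 i.

Definition Wstar {R : realType} {d : nat} (W : set 'rV[R]_d) (c : 'rV[R]_d) :
    set 'rV[R]_d :=
  [set w | W w /\ forall w', W w' -> dot c w <= dot c w'].

(* For W nonempty and compact, the suprema below are over nonempty compact
   sets of reals, so they are maxima. *)
Definition max_cost {R : realType} {d : nat} (A : set 'rV[R]_d) (c : 'rV[R]_d) : R :=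
  sup [set dot c w | w in A].

Section CILO.
Context {R : realType} {k d m : nat}.
Variables (P : probability ('rV[R]_k * 'rV[R]_d)%type R) (W : set 'rV[R]_d).
Variable chat : 'rV[R]_m -> 'rV[R]_k -> 'rV[R]_d.

Definition target_loss (theta : 'rV[R]_m) : \bar R :=
  'E_P[fun xc => max_cost (Wstar W (chat theta xc.1)) xc.2].

Definition beta_star : \bar R := ereal_inf (range target_loss).

Definition beta_max : \bar R := 'E_P[fun xc => max_cost W xc.2].

Definition policies : set ('rV[R]_k -> 'rV[R]_d) :=
  [set w | measurable_fun setT w /\ forall x, W (w x)].

Definition true_cost (w : 'rV[R]_k -> 'rV[R]_d) : \bar R :=
  'E_P[fun xc => dot xc.2 (w xc.1)].

Definition predicted_cost (theta : 'rV[R]_m) (w : 'rV[R]_k -> 'rV[R]_d) : \bar R :=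
  'E_P[fun xc => dot (chat theta xc.1) (w xc.1)].

Definition budget_policies (beta : R) : set ('rV[R]_k -> 'rV[R]_d) :=
  [set w | policies w /\ (true_cost w <= beta%:E)%E].

(* The two minima are rendered as infima in the extended reals, so that their
   attainment need not be assumed. *)
Definition cilo_loss (beta : R) (theta : 'rV[R]_m) : \bar R :=
  (ereal_inf [set predicted_cost theta w | w in budget_policies beta]
   - ereal_inf [set predicted_cost theta w | w in policies])%E.

(* Finiteness of every expectation occurring in the definitions above. *)
Definition finite_expectations : Prop :=
  [/\ forall theta, P.-integrable setT
        (fun xc => (max_cost (Wstar W (chat theta xc.1)) xc.2)%:E),
      P.-integrable setT (fun xc => (max_cost W xc.2)%:E),
      forall w, policies w ->
        P.-integrable setT (fun xc => (dot xc.2 (w xc.1))%:E) &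
      forall theta w, policies w ->
        P.-integrable setT (fun xc => (dot (chat theta xc.1) (w xc.1))%:E)].

Definition ae_nonzero (theta : 'rV[R]_m) : Prop :=
  {ae P, forall xc, chat theta xc.1 <> 0}.

Definition ae_unique_solution (theta : 'rV[R]_m) : Prop :=
  {ae P, forall xc, exists! w, Wstar W (chat theta xc.1) w}.

End CILO.

(* Main.v *)
Require Import Defs.
From mathcomp Require Import all_boot all_order all_algebra.
From mathcomp Require Import all_classical all_reals all_analysis.
From mathcomp Require Import measurable_realfun lra.
Import Order.TTheory GRing.Theory Num.Theory.
Import numFieldNormedType.Exports.
Local Open Scope classical_set_scope.
Local Open Scope ring_scope.

Set Implicit Arguments.
Unset Strict Implicit.
Unset Printing Implicit Defensive.

(** Write w_theta for an optimal policy of theta, that is, a measurable map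
    with w_theta(x) in Wstar(chat_theta(x)) for every x. Such a policy exists
    (Wstar_measurable_selection): the minimizer over W of the strictly convex
    function n (c . w) + |w|^2 depends continuously on c, and as n grows it
    converges to the element of least norm of Wstar(c), so that the latter is
    a Borel function of c.

    Being pointwise optimal, w_theta minimizes the predicted cost over all
    policies. Hence the loss cilo_loss(theta) is nonnegative, and it vanishes
    as soon as w_theta respects the budget beta. As w_theta is one of the
    solutions over which the target loss takes its maximum, its true cost is
    at most target_loss(theta). So target_loss(theta) <= beta forces
    cilo_loss(theta) = 0, and theta is a minimizer. Since beta_star is attained
    and at most beta, the minimum of cilo_loss over all parameters is exactly 0.

    Conversely let theta be a minimizer with chat_theta nonzero almost surely,
    so that cilo_loss(theta) = 0. Then there are policies v_n within the budget
    whose predicted cost exceeds that of w_theta by at most 2^-(n+1). The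
    nonnegative gaps chat_theta(x) . (v_n(x) - w_theta(x)) have a summable
    sequence of integrals, so they tend to 0 almost surely
    (fast_integral_ae_cvg0); as W is compact and the solution is almost surely
    unique, v_n(x) tends to w_theta(x) almost surely (minimizing_cvg). All the
    costs c . v_n(x) are bounded by one integrable function of c
    (dot_dominated), so dominated convergence passes the budget constraint to
    the limit: the true cost of w_theta is at most beta. By uniqueness this
    true cost is target_loss(theta). *)

(** * The pairing of costs and decisions *)

Section dot.
Context {R : realType} {d : nat}.
Implicit Types u v w c : 'rV[R]_d.

Lemma dotC u v : dot u v = dot v u.
Proof. by apply: eq_bigr => i _; rewrite mulrC. Qed.

Lemma dotDr u v w : dot u (v + w) = dot u v + dot u w.
Proof. by rewrite -big_split; apply: eq_bigr => i _; rewrite mxE mulrDr. Qed.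

Lemma dotZr (a : R) u v : dot u (a *: v) = a * dot u v.
Proof. by rewrite big_distrr; apply: eq_bigr => i _; rewrite mxE mulrCA. Qed.

Lemma dotBr u v w : dot u (v - w) = dot u v - dot u w.
Proof. by rewrite dotDr -scaleN1r dotZr mulN1r. Qed.

Lemma dotDl u v w : dot (u + v) w = dot u w + dot v w.
Proof. by rewrite dotC dotDr !(dotC w). Qed.

Lemma dotZl (a : R) u v : dot (a *: u) v = a * dot u v.
Proof. by rewrite dotC dotZr (dotC v). Qed.

Lemma dotBl u v w : dot (u - v) w = dot u w - dot v w.
Proof. by rewrite dotC dotBr !(dotC w). Qed.

Lemma dot_self_eq0 v : dot v v <= 0 -> v = 0.
Proof.
move=> v0; have sq_ge0 i : true -> 0 <= v ord0 i * v ord0 i.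
  by rewrite -expr2 sqr_ge0.
have /eqP : dot v v = 0 by apply/eqP; rewrite eq_le v0 sumr_ge0.
rewrite psumr_eq0 => [/allP v00|//]; apply/rowP => i; rewrite mxE.
by have /eqP := v00 i (mem_index_enum i); rewrite -expr2 => /eqP;
   rewrite sqrf_eq0 => /eqP.
Qed.

Lemma le_coord_norm v i : `|v ord0 i| <= `|v|.
Proof.
have -> : `|v| = \big[Num.max/0]_ij `|v ij.1 ij.2| := mx_normrE v.
apply/bigmax_geP; right => /=.
by exists (ord0, i).
Qed.

Lemma dot_le_norm u v : `|dot u v| <= d%:R * (`|u| * `|v|).
Proof.
apply: (le_trans (ler_norm_sum _ _ _)).
have -> : d%:R * (`|u| * `|v|) = \sum_(i < d) (`|u| * `|v|).
  by rewrite sumr_const card_ord mulr_natl.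
by apply: ler_sum => i _; rewrite normrM ler_pM// le_coord_norm.
Qed.

Lemma cvg_dot {T : Type} {F : set_system T} {FF : Filter F}
    (f g : T -> 'rV[R]_d) u v :
  f t @[t --> F] --> u -> g t @[t --> F] --> v ->
  dot (f t) (g t) @[t --> F] --> dot u v.
Proof.
move=> fu gv; apply: cvg_big => [|i _]; first exact: add_continuous.
have coord (x : 'rV[R]_d) : (fun M : 'rV[R]_d => M ord0 i) @ x --> x ord0 i.
  exact: coord_continuous.
by apply: cvgM; [exact: cvg_comp fu (coord u)|exact: cvg_comp gv (coord v)].
Qed.

Lemma continuous_dotr c : continuous (dot c).
Proof.
move=> w; apply: (@cvg_dot _ (nbhs w) _ (fun=> c) id c w) => //.
exact: cvg_cst.
Qed.

End dot.

(** * Minimizers over a compact convex set *)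

Section minimizers.
Context {R : realType} {d : nat}.
Implicit Types (W A : set 'rV[R]_d) (c u w : 'rV[R]_d).

Lemma compact_continuous_min A (h : 'rV[R]_d -> R) :
  A !=set0 -> compact A -> continuous h ->
  exists2 u, A u & forall w, A w -> h u <= h w.
Proof.
move=> A0 cA ch.
have [|u /set_mem Au umin] := compact_EVT_min A0 cA (f := h).
  exact: continuous_subspaceT.
by exists u => // w Aw; apply: umin; exact: mem_set.
Qed.

(** Outside a neighbourhood V of the unique minimizer u, h attains on the
    compact set W minus V a minimum larger than h u, so that a minimizing
    family must eventually enter V. *)
Lemma minimizing_cvg {T : Type} {F : set_system T} {FF : Filter F} W
    (h : 'rV[R]_d -> R) u (y : T -> 'rV[R]_d) :
  compact W -> continuous h -> (forall w, W w -> h w <= h u -> w = u) ->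
  (forall t, W (y t)) -> h (y t) @[t --> F] --> h u -> y t @[t --> F] --> u.
Proof.
move=> cW ch uniq Wy hy U; rewrite nbhsE => -[V [oV Vu] VU].
apply: (@filterS _ F _ (y @^-1` V)); first by move=> t /= /VU.
have cWV : compact (W `\` V).
  apply: (subclosed_compact _ cW); last by move=> w [].
  rewrite setDE; apply: closedI; last exact: open_closedC.
  exact: (compact_closed (@norm_hausdorff _ _)).
have [WV0|/set0P WV0] := eqVneq (W `\` V) set0.
  apply: nearW => t; rewrite /=; apply: contrapT => nVy.
  by have : (W `\` V) (y t) by []; rewrite WV0.
have [v [Wv nVv] vmin] := compact_continuous_min WV0 cWV ch.
have huv : h u < h v.
  by rewrite ltNge; apply/negP => /(uniq _ Wv) vu; apply: nVv; rewrite vu.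
apply: (@filterS _ F _ (fun t => h (y t) < h v)); last exact: cvgr_lt hy _ huv.
move=> t /= hyv; apply: contrapT => nVy; have /vmin : (W `\` V) (y t) by [].
by rewrite leNgt hyv.
Qed.

(** Midpoints are the only convex combinations that the uniqueness of
    minimizers of strictly convex functions calls for. *)
Definition midconvex A := forall v w, A v -> A w -> A (2^-1 *: (v + w)).

Lemma convex_midconvex A : convex_set A -> midconvex A.
Proof.
move=> cA v w Av Aw.
have half01 : (0 <= 2^-1 :> R) && (2^-1 <= 1 :> R).
  by apply/andP; split; lra.
pose half := Itv01 (andP half01).1 (andP half01).2.
have /set_mem := cA v w half (mem_set Av) (mem_set Aw); congr (A _).
rewrite /conv /= scalerDr; congr (_ + _ *: _).
rewrite /half /Itv01 /unstable.onem /=; lra.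
Qed.

(** The linear cost regularized by the squared Euclidean norm. Its minimizer
    over W is the Euclidean projection of - c / 2 onto W. *)
Definition qcost c w := dot c w + dot w w.

Lemma continuous_qcost c : continuous (qcost c).
Proof.
move=> w; apply: (@cvgD _ R _ (nbhs w) _ (dot c) (fun w => dot w w)).
  exact: continuous_dotr.
exact: (@cvg_dot _ _ _ (nbhs w) _ id id w w).
Qed.

(** Strict convexity: at the midpoint of u and w, qcost is below the average of
    its two values by |w - u|^2 / 4. *)
Lemma qcost_min_unique A c u : midconvex A -> A u ->
  (forall w, A w -> qcost c u <= qcost c w) ->
  forall w, A w -> qcost c w <= qcost c u -> w = u.
Proof.
move=> cA Au umin w Aw wu.
apply/eqP; rewrite -subr_eq0; apply/eqP/dot_self_eq0.
have := umin _ (cA _ _ Aw Au); move: wu; rewrite /qcost.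
rewrite !(dotBr, dotBl, dotZr, dotZl, dotDr, dotDl) (dotC u w); lra.
Qed.

(** By optimality at both costs, p c' is within O(|c - c'|) of being optimal at
    cost c, so minimizing_cvg applies. *)
Lemma qcost_minimizer_continuous W (p : 'rV[R]_d -> 'rV[R]_d) :
  compact W -> midconvex W -> (forall c, W (p c)) ->
  (forall c w, W w -> qcost c (p c) <= qcost c w) -> continuous p.
Proof.
move=> cW mW Wp pmin c.
apply: (@minimizing_cvg _ (nbhs c) _ W (qcost c) (p c) p) => //.
- exact: continuous_qcost.
- exact: (qcost_min_unique mW (Wp c) (pmin c)).
have [M WM] : exists M, forall w, W w -> `|w| <= M.
  have [M [Mreal WM]] := compact_bounded cW.
  by exists (M + 1) => w; apply: WM; rewrite ltrDl.
have gap c' : `|qcost c (p c') - qcost c (p c)| <= (d%:R * (M + M)) * `|c - c'|.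
  rewrite ger0_norm; last by rewrite subr_ge0 pmin.
  have step : qcost c (p c') - qcost c (p c) <= dot (c' - c) (p c - p c').
    have := pmin c' _ (Wp c); rewrite /qcost !(dotBr, dotBl); lra.
  apply: (le_trans step); apply: (le_trans (ler_norm _)).
  apply: (le_trans (dot_le_norm _ _)); rewrite -mulrA ler_wpM2l//.
  rewrite mulrC (distrC c') ler_wpM2r//.
  by rewrite (le_trans (ler_normB _ _))// lerD// WM.
have lip : (d%:R * (M + M)) * `|c - c'| @[c' --> c] --> (0 : R).
  have dist0 : `|c - c'| @[c' --> c] --> (0 : R).
    have := @cvg_norm _ _ _ (nbhs c) _ _ _
      (cvgB (@cvg_cst _ c _ (nbhs c) _) (@cvg_id _ (nbhs c))).
    by rewrite subrr normr0; apply.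
  rewrite -[X in _ --> X](mulr0 (d%:R * (M + M))).
  exact: (@cvgM _ _ (nbhs c) _ (fun=> d%:R * (M + M)) _ _ _
    (@cvg_cst R _ _ (nbhs c) _) dist0).
apply/cvgrPdist_le => e e0.
apply: (@filterS _ (nbhs c) _ [set c' | (d%:R * (M + M)) * `|c - c'| < e]).
  by move=> c' /= /ltW lipe; rewrite distrC (le_trans (gap _)).
exact: cvgr_lt lip _ e0.
Qed.

Lemma qcost_minimizer_exists W :
  W !=set0 -> compact W -> midconvex W ->
  exists p : 'rV[R]_d -> 'rV[R]_d, [/\ continuous p, forall c, W (p c) &
    forall c w, W w -> qcost c (p c) <= qcost c w].
Proof.
move=> W0 cW mW.
have /choice[p pP] c : exists u, W u /\ forall w, W w -> qcost c u <= qcost c w.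
  have [u Wu umin] := compact_continuous_min W0 cW (@continuous_qcost c).
  by exists u.
have Wp c : W (p c) by have [] := pP c.
have pmin c w : W w -> qcost c (p c) <= qcost c w by have [_ +] := pP c; exact.
by exists p; split => //; exact: qcost_minimizer_continuous pmin.
Qed.

(** The squared norm is qcost 0, and Wstar W c is again compact and stable under
    midpoints. *)
Lemma Wstar_min_norm W c : W !=set0 -> compact W -> midconvex W ->
  exists2 u, Wstar W c u & forall w, Wstar W c w -> dot w w <= dot u u -> w = u.
Proof.
move=> W0 cW mW.
have [v Wv vmin] := compact_continuous_min W0 cW (@continuous_dotr _ _ c).
have cWstar : compact (Wstar W c).
  have -> : Wstar W c = W `&` dot c @^-1` [set x | x <= dot c v].
    apply/seteqP; split => w [Ww wmin]; split=> //; first exact: wmin.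
    by move=> w' /vmin; exact: le_trans.
  apply: (subclosed_compact _ cW); last by move=> w [].
  apply: closedI; first exact: (compact_closed (@norm_hausdorff _ _)).
  apply: preimage_closed; last exact: closed_le.
  move=> w _; exact: continuous_dotr.
have mWstar : midconvex (Wstar W c).
  move=> w w' [Ww wmin] [Ww' w'min]; split; first exact: mW.
  move=> z Wz; have := wmin _ Wz; have := w'min _ Wz.
  rewrite dotZr dotDr; lra.
have q0 w : qcost 0 w = dot w w.
  by rewrite /qcost -(scale0r (0 : 'rV[R]_d)) dotZl mul0r add0r.
have [u uW umin] := compact_continuous_min (ex_intro _ v (conj Wv vmin)) cWstar
  (@continuous_qcost 0).
exists u => // w wW; rewrite -!q0.
exact: (qcost_min_unique mWstar).
Qed.

(** Comparing p (n c) with the element u of least norm of Wstar W c shows both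
    that |p (n c)| <= |u| and that the linear cost of p (n c) exceeds that of u
    by at most |u|^2 / n. *)
Lemma qcost_minimizer_cvg W (p : 'rV[R]_d -> 'rV[R]_d) c u :
  compact W -> (forall c, W (p c)) ->
  (forall c w, W w -> qcost c (p c) <= qcost c w) ->
  Wstar W c u -> (forall w, Wstar W c w -> dot w w <= dot u u -> w = u) ->
  p (n.+1%:R *: c) @[n --> \oo] --> u.
Proof.
move=> cW Wp pmin [Wu umin] uuniq.
(* On W, the function h below is nonnegative and vanishes only at u: its first
   term measures the excess of linear cost, and its second one, twice the
   positive part of b, the excess of squared norm. *)
pose a w := dot c w - dot c u; pose b w := dot w w - dot u u.
pose h w := a w + (b w + `|b w|).
have hu : h u = 0 by rewrite /h /a /b !subrr normr0 !addr0.
have b_ge0 w : 0 <= b w + `|b w|.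
  by have := ler_norm (- b w); rewrite normrN; lra.
have a_ge0 w : W w -> 0 <= a w by move=> Ww; rewrite subr_ge0 umin.
apply: (@minimizing_cvg _ _ _ W h) => //.
- have ca : continuous a.
    move=> w; apply: (@cvgB _ R _ (nbhs w) _ (dot c) (fun=> dot c u)).
      exact: continuous_dotr.
    exact: cvg_cst.
  have cb : continuous b.
    move=> w.
    apply: (@cvgB _ R _ (nbhs w) _ (fun w => dot w w) (fun=> dot u u)).
      exact: (@cvg_dot _ _ _ (nbhs w) _ id id w w).
    exact: cvg_cst.
  move=> w; apply: (@cvgD _ R _ (nbhs w) _ a (fun w => b w + `|b w|)).
    exact: ca.
  apply: (@cvgD _ R _ (nbhs w) _ b (fun w => `|b w|)); first exact: cb.
  exact: (@cvg_norm _ _ _ (nbhs w) _ b _ (cb w)).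
- move=> w Ww; rewrite hu /h => hw_le0.
  have aw := a_ge0 _ Ww; have bw := b_ge0 w.
  apply: uuniq; first split=> // w' /umin.
    by apply: le_trans; rewrite -subr_le0 -/(a w); lra.
  rewrite -subr_le0 -/(b w); have := ler_norm (b w); lra.
rewrite hu.
have hp n : 0 <= h (p (n.+1%:R *: c)) <= dot u u * n.+1%:R^-1.
  set y := p _; have n0 : 0 < n.+1%:R :> R by [].
  have := pmin (n.+1%:R *: c) _ Wu; have ay := a_ge0 y (Wp _).
  rewrite /qcost !dotZl -/y; set k := n.+1%:R in n0 *.
  have yy : 0 <= dot y y by apply: sumr_ge0 => i _; rewrite -expr2 sqr_ge0.
  have kay : 0 <= k * (dot c y - dot c u) by rewrite mulr_ge0// ltW.
  rewrite mulrBr in kay; move=> le.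
  have by0 : b y <= 0 by rewrite /b; lra.
  rewrite /h (ler0_norm by0) subrr addr0 ay /= ler_pdivlMr// mulrC mulrBr; lra.
apply: (@squeeze_cvgr _ _ _ _ (fun=> 0) (fun n => dot u u * n.+1%:R^-1)).
- by apply: nearW => n; exact: hp.
- exact: cvg_cst.
rewrite -[X in _ --> X](mulr0 (dot u u)).
exact: (cvgM (@cvg_cst _ _ _ _ _) (@cvg_harmonic R)).
Qed.

End minimizers.

(** * Borel selection of optimal decisions *)

Section measurable_vectors.
Context {R : realType}.

Lemma open_measurable_rV p (U : set 'rV[R]_p) : open U -> measurable U.
Proof. by move=> oU; exact: sub_sigma_algebra. Qed.

Lemma measurable_fun_rV dT (T : measurableType dT) p (f : T -> 'rV[R]_p) :
  (forall U, open U -> measurable (f @^-1` U)) -> measurable_fun setT f.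
Proof.
move=> mf; apply: (measurability (@open 'rV[R]_p)) => // _ [U oU <-].
by rewrite setTI; exact: mf.
Qed.

Lemma continuous_measurable_rV p q (f : 'rV[R]_p -> 'rV[R]_q) :
  continuous f -> measurable_fun setT f.
Proof.
move=> /continuousP cf; apply: measurable_fun_rV => U oU.
apply: open_measurable_rV; exact: cf.
Qed.

(** The limit lies in the open set U if and only if, for some radius, the balls
    of that radius around all the late terms of the sequence are included in U;
    the centres of such balls form a closed set. *)
Lemma measurable_fun_rV_cvg dT (T : measurableType dT) p
    (g : nat -> T -> 'rV[R]_p) (f : T -> 'rV[R]_p) :
  (forall n, measurable_fun setT (g n)) ->
  (forall t, g n t @[n --> \oo] --> f t) -> measurable_fun setT f.
Proof.
move=> mg gf; apply: measurable_fun_rV => U oU.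
pose V j := [set x : 'rV[R]_p | ball x j.+1%:R^-1 `<=` U].
have mV j : measurable (V j).
  rewrite -[V j]setCK; apply: measurableC; apply: open_measurable_rV.
  have -> : ~` V j = \bigcup_(y in ~` U) ball y j.+1%:R^-1.
    apply/seteqP; split => [x /existsNP[y /not_implyP[xy nUy]]|x [y nUy yx] xU].
      by exists y => //; exact: ball_sym.
    by apply: nUy; apply: xU; exact: ball_sym.
  by apply: bigcup_open => y _; exact: ball_open.
have -> : f @^-1` U =
    \bigcup_j \bigcup_N \bigcap_(n in [set n | (N <= n)%N]) g n @^-1` V j.
  apply/seteqP; split => [t /= Uft|t [j _ [N _ gV]]]; last first.
    have [M _ gM] := gf t _ (nbhsx_ballx (f t) j.+1%:R^-1 ltac:(by [])).
    apply: (gV (maxn N M)); first by rewrite /= leq_maxl.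
    by apply: ball_sym; apply: gM; rewrite /= leq_maxr.
  have /nbhs_ballP[e /= e0 eU] : nbhs (f t) U by apply: open_nbhs_nbhs.
  have e20 : 0 < e / 2 by rewrite divr_gt0.
  have [j je] : exists j : nat, j.+1%:R^-1 < e / 2.
    have [j _ jP] := near_infty_natSinv_lt (PosNum e20).
    by exists j; apply: (jP j); rewrite /= leqnn.
  have [N _ gN] := gf t _ (nbhsx_ballx (f t) (e / 2) e20).
  exists j => //; exists N => // n Nn y /= gny; apply: eU.
  rewrite (splitr e); apply: ball_triangle (gN _ Nn) _.
  exact: le_ball (ltW je) _ gny.
apply: bigcupT_measurable => j; apply: bigcupT_measurable => N.
apply: bigcap_measurable; first by exists N => /=.
by move=> n _; rewrite -[_ @^-1` _]setTI; exact: mg.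
Qed.

(** The element of least norm of Wstar W c is a pointwise limit of continuous
    functions of c. *)
Lemma Wstar_measurable_selection d (W : set 'rV[R]_d) :
  W !=set0 -> compact W -> midconvex W ->
  exists2 s : 'rV[R]_d -> 'rV[R]_d, measurable_fun setT s &
    forall c, Wstar W c (s c).
Proof.
move=> W0 cW mW.
have [p [cp Wp pmin]] := qcost_minimizer_exists W0 cW mW.
have /choice[s sP] c : exists u, Wstar W c u /\
    forall w, Wstar W c w -> dot w w <= dot u u -> w = u.
  by have [u uW uuniq] := Wstar_min_norm c W0 cW mW; exists u.
exists s; last by move=> c; have [] := sP c.
have := @measurable_fun_rV_cvg _ 'rV[R]_d d (fun n c => p (n.+1%:R *: c)) s.
apply => [n|c].
  apply: continuous_measurable_rV => c.
  apply: (@continuous_comp _ _ _ (fun c => n.+1%:R *: c) p c);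
    last exact: cp.
  apply: scaler_continuous.
by have [sW suniq] := sP c; exact: qcost_minimizer_cvg cW Wp pmin sW suniq.
Qed.

End measurable_vectors.

(** * Domination of all costs by finitely many of them *)

Section domination.
Context {R : realType} {d : nat}.

Lemma dot_mulmx n (c : 'rV[R]_d) (b : 'rV[R]_n) (A : 'M[R]_(n, d)) :
  dot c (b *m A) = \sum_i b ord0 i * dot c (row i A).
Proof.
rewrite /dot; under eq_bigr do rewrite mxE big_distrr.
rewrite exchange_big; apply: eq_bigr => i _; rewrite big_distrr.
by apply: eq_bigr => j _; rewrite mxE /= mulrCA.
Qed.

(** A matrix of largest rank among those whose rows are elements of W spans W:
    another element of W outside its row space could be appended to it. *)
Lemma spanning_rows (W : set 'rV[R]_d) :
  exists n (A : 'M[R]_(n, d)), (forall i, W (row i A)) /\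
    forall w, W w -> (w <= A)%MS.
Proof.
pose hasrank r := `[< exists n (A : 'M[R]_(n, d)), (forall i, W (row i A)) /\
  \rank A = r >].
have ex0 : exists r, hasrank r.
  by exists 0%N; apply/asboolP; exists 0%N, 0; split=> [[]//|]; rewrite mxrank0.
have rank_le r : hasrank r -> (r <= d)%N.
  by move=> /asboolP[n [A [_ <-]]]; exact: rank_leq_col.
case: (ex_maxnP ex0 rank_le) => r /asboolP[n [A [WA rA]]] rmax.
exists n, A; split=> // w Ww.
have WAw i : W (row i (col_mx A w)).
  rewrite -(splitK i); case: (fintype.split i) => j /=.
    by rewrite rowKu; exact: WA.
  by rewrite rowKd (_ : row j w = w)//; apply/rowP => k; rewrite mxE ord1.
have le_rank : (\rank (col_mx A w) <= \rank A)%N.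
  by rewrite rA; apply: rmax; apply/asboolP; exists (n + 1)%N, (col_mx A w).
have AAw : (A <= col_mx A w)%MS by rewrite -addsmxE addsmxSl.
have /eqmxP eqA : (A == col_mx A w)%MS.
  by rewrite -(mxrank_leqif_eq AAw) eqn_leq le_rank mxrankS.
by rewrite eqA -addsmxE addsmxSr.
Qed.

(** Every w in W is a combination of fixed spanning elements of W, with
    coefficients that are linear in w, hence bounded on W. As the costs of
    constant policies are integrable, the right-hand side is an integrable
    bound for the costs of all policies at once. *)
Lemma dot_dominated (W : set 'rV[R]_d) : bounded_set W ->
  exists n (a : 'I_n -> 'rV[R]_d) (K : R), (forall i, W (a i)) /\
    forall c w, W w -> `|dot c w| <= K * \sum_i `|dot c (a i)|.
Proof.
move=> [M0 [_ WM0]]; have [n [A [WA spanA]]] := spanning_rows W.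
have [M M_ge0 WM] : exists2 M, 0 <= M & forall w, W w -> `|w| <= M.
  exists (`|M0| + 1); first by rewrite addr_ge0.
  by apply: WM0; rewrite (le_lt_trans (ler_norm _))// ltrDl.
pose K := \sum_i M * (\sum_j `|pinvmx A j i|).
exists n, (fun i => row i A), K; split => // c w Ww.
rewrite -(mulmxKpV (spanA _ Ww)) dot_mulmx big_distrr.
apply: (le_trans (ler_norm_sum _ _ _)); apply: ler_sum => i _.
rewrite normrM ler_wpM2r// mxE.
apply: (le_trans (ler_norm_sum _ _ _)).
have KE i' : 0 <= M * (\sum_j `|pinvmx A j i'|) by rewrite mulr_ge0// sumr_ge0.
apply: (@le_trans _ _ (M * (\sum_j `|pinvmx A j i|))); last first.
  by rewrite /K (bigD1 i)//= lerDl sumr_ge0.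
rewrite big_distrr; apply: ler_sum => j _; rewrite normrM ler_wpM2r//.
exact: le_trans (le_coord_norm w j) (WM _ Ww).
Qed.

End domination.

(** * Almost sure convergence from fast decay of the integrals *)

Lemma nneseries_fin_cvg0 (R : realType) (u : nat -> R) :
  (forall n, 0 <= u n) -> (\sum_(n <oo) (u n)%:E \is a fin_num)%E ->
  u n @[n --> \oo] --> 0.
Proof.
move=> u0 ufin; apply: cvg_series_cvg_0; apply: nondecreasing_is_cvgn.
  by apply/nondecreasing_seqP => n; rewrite /series /= big_nat_recr//= lerDl.
exists (fine (\sum_(n <oo) (u n)%:E)%E) => _ [n _ <-].
rewrite -lee_fin fineK// /series /= -sumEFin.
by apply: nneseries_lim_ge => i _ _; rewrite lee_fin.
Qed.

(** By monotone convergence the sum of all the g n has integral at most 1, so it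
    is finite almost everywhere. *)
Lemma fast_integral_ae_cvg0 dT (T : measurableType dT) (R : realType)
    (mu : measure T R) (g : nat -> T -> R) :
  (forall n, measurable_fun setT (fun t => (g n t)%:E)) ->
  (forall n t, 0 <= g n t) ->
  (forall n, (\int[mu]_t (g n t)%:E <= (1 / (2 ^ n.+1)%:R)%:E)%E) ->
  {ae mu, forall t, g n t @[n --> \oo] --> 0}.
Proof.
move=> mg g0 intg; pose S t := (\sum_(n <oo) (g n t)%:E)%E.
have S0 t : (0 <= S t)%E by apply: nneseries_ge0 => n _ _; rewrite lee_fin.
have intS : (\int[mu]_t S t <= 1%:E)%E.
  rewrite integral_nneseries//; last by move=> n t _; rewrite lee_fin.
  apply: le_trans (epsilon_trick0 xpredT ler01).
  apply: lee_nneseries => [n _ _|n _]; last exact: intg.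
  by apply: integral_ge0 => t _; rewrite lee_fin.
have iS : mu.-integrable setT S.
  apply/integrableP; split.
    by apply: ge0_emeasurable_sum => // n t _ _; rewrite lee_fin.
  under eq_integral do rewrite gee0_abs//.
  exact: le_lt_trans intS (ltry _).
have := integrable_ae measurableT iS; apply: filterS => t /(_ I) St.
exact: nneseries_fin_cvg0.
Qed.

(** * Optimal policies, the target loss and the loss of a budget *)

Section cilo.
Context {R : realType} {k d m : nat}.
Context (P : probability ('rV[R]_k * 'rV[R]_d)%type R) (W : set 'rV[R]_d).
Context (chat : 'rV[R]_m -> 'rV[R]_k -> 'rV[R]_d).
Implicit Types (theta : 'rV[R]_m) (w v : 'rV[R]_k -> 'rV[R]_d).

Definition optimal_policy theta w :=
  policies W w /\ forall x, Wstar W (chat theta x) (w x).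

Lemma optimal_policy_exists theta :
  W !=set0 -> compact W -> midconvex W -> measurable_fun setT (chat theta) ->
  exists w, optimal_policy theta w.
Proof.
move=> W0 cW mW mchat.
have [s ms sW] := Wstar_measurable_selection W0 cW mW.
exists (s \o chat theta); split; last by move=> x; exact: sW.
by split=> [|x]; [exact: measurableT_comp|case: (sW (chat theta x))].
Qed.

Context (cW : compact W) (fin_exp : finite_expectations P W chat).

Let target_integrable theta : P.-integrable setT
  (fun xc => (max_cost (Wstar W (chat theta xc.1)) xc.2)%:E).
Proof. by case: fin_exp. Qed.

Let true_integrable w : policies W w ->
  P.-integrable setT (fun xc => (dot xc.2 (w xc.1))%:E).
Proof. by case: fin_exp => _ _ + _; exact. Qed.

Let predicted_integrable theta w : policies W w ->
  P.-integrable setT (fun xc => (dot (chat theta xc.1) (w xc.1))%:E).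
Proof. by case: fin_exp => _ _ _; exact. Qed.

Lemma predicted_cost_fin theta w :
  policies W w -> predicted_cost P chat theta w \is a fin_num.
Proof.
move=> pw; rewrite /predicted_cost unlock.
by apply: integrable_fin_num => //; exact: predicted_integrable.
Qed.

Lemma optimal_policy_le theta w v : optimal_policy theta w -> policies W v ->
  (predicted_cost P chat theta w <= predicted_cost P chat theta v)%E.
Proof.
move=> [pw wW] pv; rewrite /predicted_cost unlock.
apply: le_integral => //; try exact: predicted_integrable.
by move=> xc _; rewrite lee_fin; have [_] := wW xc.1; apply; exact: pv.2.
Qed.

Lemma true_cost_le_target theta w : optimal_policy theta w ->
  (true_cost P w <= target_loss P W chat theta)%E.
Proof.
move=> [pw wW]; rewrite /true_cost /target_loss unlock.
apply: le_integral => //; first exact: true_integrable.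
move=> xc _; rewrite lee_fin; apply: ub_le_sup; last by exists (w xc.1).
have [M [Mreal WM]] := compact_bounded cW.
exists (d%:R * (`|xc.2| * (M + 1))) => _ [u [Wu _] <-].
apply: (le_trans (ler_norm _)); apply: (le_trans (dot_le_norm _ _)).
by rewrite !ler_wpM2l//; apply: WM => //; rewrite ltrDl.
Qed.

(** Where the solution is unique, the maximum defining the target loss ranges
    over a single decision. *)
Lemma true_cost_eq_target theta w :
  ae_unique_solution P W chat theta -> optimal_policy theta w ->
  true_cost P w = target_loss P W chat theta.
Proof.
move=> uniq [pw wW]; rewrite /true_cost /target_loss unlock.
apply: ae_eq_integral => //.
- exact: measurable_int (true_integrable pw).
- exact: measurable_int (target_integrable theta).
move: uniq; apply: filterS => xc [u [_ uuniq]] _.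
have -> : Wstar W (chat theta xc.1) = [set w xc.1].
  apply/seteqP; split => [v /uuniq <-|_ ->]; last exact: wW.
  by rewrite /=; apply: uuniq.
by rewrite /max_cost image_set1 sup1.
Qed.

Lemma inf_predicted_cost theta w : optimal_policy theta w ->
  ereal_inf [set predicted_cost P chat theta v | v in policies W] =
  predicted_cost P chat theta w.
Proof.
move=> ow; apply/eqP; rewrite eq_le; apply/andP; split.
  by apply: ereal_inf_lbound; exists w => //; exact: ow.1.
by apply: le_ereal_inf_tmp => _ [v pv <-]; exact: optimal_policy_le.
Qed.

(** The infimum over all policies is subtracted safely because the optimal
    policy makes it a finite number. *)
Lemma cilo_loss_ge0 beta theta w : optimal_policy theta w ->
  (0 <= cilo_loss P W chat beta theta)%E.
Proof.
move=> ow; rewrite /cilo_loss (inf_predicted_cost ow) sube_ge0; last first.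
  by rewrite predicted_cost_fin//; exact: ow.1.
by apply: le_ereal_inf_tmp => _ [v [pv _] <-]; exact: optimal_policy_le.
Qed.

Lemma cilo_loss_le0 beta theta w : optimal_policy theta w ->
  (true_cost P w <= beta%:E)%E -> (cilo_loss P W chat beta theta <= 0)%E.
Proof.
move=> ow wbeta; rewrite /cilo_loss (inf_predicted_cost ow).
rewrite sube_le0.
by apply: ereal_inf_lbound; exists w => //; split => //; exact: ow.1.
Qed.

Lemma true_cost_cvg (w : 'rV[R]_k -> 'rV[R]_d)
    (v : nat -> 'rV[R]_k -> 'rV[R]_d) :
  policies W w -> (forall n, policies W (v n)) ->
  {ae P, forall xc, v n xc.1 @[n --> \oo] --> w xc.1} ->
  true_cost P (v n) @[n --> \oo] --> true_cost P w.
Proof.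
move=> pw pv vw; rewrite /true_cost unlock.
have [n [a [K [Wa dom]]]] := dot_dominated (compact_bounded cW).
pose g (xc : 'rV[R]_k * 'rV[R]_d) : \bar R := (K * \sum_i `|dot xc.2 (a i)|)%:E.
have ig : P.-integrable setT g.
  rewrite /g; under eq_fun do rewrite EFinM -sumEFin.
  apply: integrableZl => //; apply: integrable_sum => // i _.
  apply: (@integrable_norm _ _ _ _ _ (fun xc => dot xc.2 (a i))).
  by apply: (true_integrable (w := fun=> a i)); split => // x; exact: Wa.
have mv j : measurable_fun setT
    (fun xc : 'rV[R]_k * 'rV[R]_d => (dot xc.2 (v j xc.1))%:E).
  exact: measurable_int (true_integrable (pv j)).
have mw := measurable_int P (true_integrable pw).
have [||_ _] := dominated_convergence measurableT mv mw _ ig _ => //.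
- move: vw; apply: filterS => xc vw _.
  by apply: cvg_EFin; [exact: nearW|apply: cvg_dot => //; exact: cvg_cst].
- by apply: aeW => xc j _; rewrite lee_fin dom//; exact: (pv j).2.
Qed.

(** A vanishing loss only provides policies within the budget that are nearly
    optimal for the predicted cost; uniqueness of the solution makes them
    converge to the optimal policy, which inherits the budget. *)
Lemma true_cost_le_of_cilo_le0 beta theta w :
  ae_unique_solution P W chat theta -> optimal_policy theta w ->
  (cilo_loss P W chat beta theta <= 0)%E -> (true_cost P w <= beta%:E)%E.
Proof.
move=> uniq ow; have [pw wW] := ow.
rewrite /cilo_loss (inf_predicted_cost ow) sube_le0.
set costs := (X in ereal_inf X) => infle.
have infE : ereal_inf costs = predicted_cost P chat theta w.
  apply/eqP; rewrite eq_le infle /=.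
  by apply: le_ereal_inf_tmp => _ [v [pv _] <-]; exact: optimal_policy_le.
have /choice[v vP] (n : nat) : exists v, budget_policies P W beta v /\
    (predicted_cost P chat theta v <=
     predicted_cost P chat theta w + (1 / (2 ^ n.+1)%:R)%:E)%E.
  have n0 : 0 < 1 / (2 ^ n.+1)%:R :> R by rewrite divr_gt0// ltr0n expn_gt0.
  have [|_ [v bv <-] /ltW vle] := lb_ereal_inf_adherent n0 (S := costs).
    by rewrite infE predicted_cost_fin.
  by exists v; split => //; rewrite -infE.
have pv n : policies W (v n) by have [[]] := vP n.
pose gap n (xc : 'rV[R]_k * 'rV[R]_d) :=
  dot (chat theta xc.1) (v n xc.1) - dot (chat theta xc.1) (w xc.1).
have gap0 : {ae P, forall xc, gap n xc @[n --> \oo] --> 0}.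
  apply: fast_integral_ae_cvg0 => [n|n xc|n].
  - exact: measurable_int (integrableB measurableT
      (predicted_integrable theta (pv n)) (predicted_integrable theta pw)).
  - by rewrite subr_ge0; have [_] := wW xc.1; apply; exact: (pv n).2.
  - under eq_integral do rewrite /gap EFinB.
    rewrite integralB_EFin//; [|exact: predicted_integrable..].
    have := (vP n).2; rewrite -leeBlDl ?predicted_cost_fin//.
    by rewrite /predicted_cost unlock.
have vw : {ae P, forall xc, v n xc.1 @[n --> \oo] --> w xc.1}.
  apply: filterS2 uniq gap0 => xc [u [_ uuniq]] gap0.
  apply: (minimizing_cvg cW (@continuous_dotr _ _ (chat theta xc.1))).
  - move=> z Wz zw; have <- := uuniq _ (wW xc.1); apply/esym/uuniq.
    by split=> // z' /((wW xc.1).2 _); exact: le_trans.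
  - by move=> n; exact: (pv n).2.
  - by apply/subr_cvg0.
apply: cvge_le (true_cost_cvg pw pv vw).
by apply: nearW => n; have [[]] := vP n.
Qed.

End cilo.

Theorem theorem1 (R : realType) (k d m : nat)
    (P : probability ('rV[R]_k * 'rV[R]_d)%type R)
    (W : set 'rV[R]_d)
    (chat : 'rV[R]_m -> 'rV[R]_k -> 'rV[R]_d)
    (beta : R)
    (W_nonempty : W !=set0)
    (W_convex : convex_set W)
    (W_closed : closed W)
    (W_bounded : bounded_set W)
    (chat_measurable : forall theta, measurable_fun setT (chat theta))
    (finite : finite_expectations P W chat)
    (beta_star_attained : exists theta, minimizer (target_loss P W chat) theta)
    (unique : forall theta,
       ae_nonzero P chat theta -> ae_unique_solution P W chat theta)
    (beta_ge : (beta_star P W chat <= beta%:E)%E)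
    (beta_lt : (beta%:E < beta_max P W)%E) :
  (forall theta, ae_nonzero P chat theta ->
     ((target_loss P W chat theta <= beta%:E)%E <->
      minimizer (cilo_loss P W chat beta) theta)) /\
  (beta%:E = beta_star P W chat ->
   forall theta, ae_nonzero P chat theta ->
     (minimizer (cilo_loss P W chat beta) theta <->
      minimizer (target_loss P W chat) theta)).
Proof.
have cW : compact W := bounded_closed_compact W_bounded W_closed.
have optimal theta : exists w, optimal_policy W chat theta w.
  by apply: optimal_policy_exists => //; exact: convex_midconvex.
have loss_le0 theta : (target_loss P W chat theta <= beta%:E)%E ->
    (cilo_loss P W chat beta theta <= 0)%E.
  move=> le_beta; have [w ow] := optimal theta.
  apply: (cilo_loss_le0 finite ow).
  exact: le_trans (true_cost_le_target cW finite ow) le_beta.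
have [theta0 min0] := beta_star_attained.
have theta0_le0 : (cilo_loss P W chat beta theta0 <= 0)%E.
  apply: loss_le0; apply: le_trans beta_ge.
  by apply: le_ereal_inf_tmp => _ [theta _ <-]; exact: min0.
have main theta : ae_nonzero P chat theta ->
    ((target_loss P W chat theta <= beta%:E)%E <->
     minimizer (cilo_loss P W chat beta) theta).
  move=> /unique uniq; split=> [/loss_le0 le0 theta'|mintheta].
    have [w ow] := optimal theta'.
    by apply: (le_trans le0); exact: cilo_loss_ge0 ow.
  have [w ow] := optimal theta.
  rewrite -(true_cost_eq_target finite uniq ow).
  apply: (true_cost_le_of_cilo_le0 cW finite uniq ow).
  exact: le_trans (mintheta theta0) theta0_le0.
split=> // betaE theta nz; apply: (iff_trans (iff_sym (main theta nz))).
split=> [le_beta theta'|mintheta].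
  apply: (le_trans le_beta); rewrite betaE.
  by apply: ereal_inf_lbound; exists theta'.
by rewrite betaE; apply: le_ereal_inf_tmp => _ [theta' _ <-]; exact: mintheta.
Qed.
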